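(* Let $W^*\in\mathbb{R}^{d\times q}$ be a fixed point of the ISM iteration $W_{k+1}=\mathrm{eig}_{\min}(\Phi(W_k))$. Let $\Lambda_1^*,\dots,\Lambda_q^*$ be the $q$ smallest eigenvalues of $\Phi(W^* )$ and $\bar\Lambda_1^*,\dots,\bar\Lambda_{d-q}^*$ the remaining eigenvalues of $\Phi(W^* )$ (counted with multiplicity). Suppose that $\Phi(W^* )$ has full rank and that $\sigma$ is large enough, in the sense that $$\sigma^2\Big[\min_i \bar\Lambda_i^* - \max_j \Lambda_j^*\Big]\;\ge\;\sum_{i,j}\frac{|\gamma_{i,j}|}{\sigma^2}\,e^{-\frac{\operatorname{Tr}(W^{*T}A_{i,j}W^* )}{2\sigma^2}}\operatorname{Tr}(A_{i,j}^TA_{i,j}).$$ Then $W^*$ satisfies the first- and second-order necessary conditions for a local minimum of the problem: minimize $F(W)=-\sum_{i,j}\gamma_{i,j}e^{-\operatorname{Tr}(W^TA_{i,j}W)/(2\sigma^2)}$ over $W\in\mathbb{R}^{d\times q}$ subject to $W^TW=I$. That is, there is $\Lambda^*\in\mathbb{R}^{q\times q}$ such that (a) $\nabla_W\mathcal{L}(W^*,\Lambda^* )=0$; (b) $\nabla_\Lambda\mathcal{L}(W^*,\Lambda^* )=0$ (equivalently $W^{*T}W^*=I$); (c) $\operatorname{Tr}\big(Z^T\,\nabla^2_{WW}\mathcal{L}(W^*,\Lambda^* )Z\big)\ge 0$ for all $Z\in\mathbb{R}^{d\times q}$, $Z\ne0$, with $Z^TW^*+W^{*T}Z=0$.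
   Context: Let $x_1,\dots,x_n\in\mathbb{R}^d$ be data points (the rows of $X\in\mathbb{R}^{n\times d}$), $1\le q<d$, $\sigma>0$, $\lambda\in\mathbb{R}$. Let $Y\in\{0,1\}^{n\times k}$ be a cluster indicator matrix ($Y_{i,j}=1$ iff $x_i$ belongs to cluster $j$), and let $U\in\mathbb{R}^{n\times k}$ be fixed with $U^TU=I$. Let $H=I-\frac1n\mathbf{1}_n\mathbf{1}_n^T$. Let $D$ be the fixed diagonal matrix with positive diagonal entries $D=\mathrm{diag}(\mathbf{1}_n^TK_{XW'})$, where $W'\in\mathbb{R}^{d\times q}$ is some fixed matrix and $(K_{XW'})_{i,j}=\exp(-\operatorname{Tr}[(x_i-x_j)^TW'W'^T(x_i-x_j)]/(2\sigma^2))$; $D$ and $U$ are treated as constants. Let $\gamma_{i,j}$ be the entries of the symmetric matrix $\gamma=D^{-1/2}H(UU^T-\lambda YY^T)HD^{-1/2}$, and $A_{i,j}=(x_i-x_j)(x_i-x_j)^T$; all sums over $i,j$ run over $1\le i,j\le n$. Define the symmetric $d\times d$ matrix $$\Phi(W)=\sum_{i,j}\frac{\gamma_{i,j}}{\sigma^2}\exp\Big(-\frac{\operatorname{Tr}[W^TA_{i,j}W]}{2\sigma^2}\Big)A_{i,j}.$$ For a symmetric $d\times d$ matrix $M$, $\mathrm{eig}_{\min}(M)$ denotes a $d\times q$ matrix whose columns are orthonormal eigenvectors of $M$ corresponding to its $q$ smallest eigenvalues (counted with multiplicity). $W^*$ is a fixed point of the ISM iteration if $W^*=\mathrm{eig}_{\min}(\Phi(W^*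 ))$, i.e. the columns of $W^*$ are orthonormal eigenvectors of $\Phi(W^* )$ for its $q$ smallest eigenvalues. The Lagrangian is $\mathcal{L}(W,\Lambda)=-\sum_{i,j}\gamma_{i,j}\exp\big(-\frac{\operatorname{Tr}(W^TA_{i,j}W)}{2\sigma^2}\big)-\frac12\operatorname{Tr}(\Lambda(W^TW-I))$, with $\Lambda\in\mathbb{R}^{q\times q}$. $\nabla^2_{WW}\mathcal{L}(W,\Lambda)Z$ denotes the directional derivative of $W\mapsto\nabla_W\mathcal{L}(W,\Lambda)$ in the direction $Z\in\mathbb{R}^{d\times q}$. *)

(* Defs.v *)
From HB Require Import structures.
From mathcomp Require Import all_boot all_order all_algebra.
From mathcomp Require Import all_classical all_reals all_analysis.

Set Implicit Arguments.
Unset Strict Implicit.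
Unset Printing Implicit Defensive.

Import Order.TTheory GRing.Theory Num.Theory.
Import numFieldNormedType.Exports.

Local Open Scope ring_scope.

(* The i-th data point as a column vector; data points are the rows of X. *)
Definition point (R : realType) (n d : nat) (X : 'M[R]_(n, d)) (i : 'I_n) :
    'cV[R]_d :=
  (row i X)^T.

Definition diff_outer (R : realType) (n d : nat) (X : 'M[R]_(n, d))
    (i j : 'I_n) : 'M[R]_d :=
  (point X i - point X j) *m (point X i - point X j)^T.

Definition gauss_weight (R : realType) (n d q : nat) (sigma : R)
    (X : 'M[R]_(n, d)) (W : 'M[R]_(d, q)) (i j : 'I_n) : R :=
  expR (- \tr (W^T *m diff_outer X i j *m W) / (2 * sigma ^+ 2)).

Definition kernel_mx (R : realType) (n d q : nat) (sigma : R)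
    (X : 'M[R]_(n, d)) (W : 'M[R]_(d, q)) : 'M[R]_n :=
  \matrix_(i, j)
    expR (- \tr ((point X i - point X j)^T *m W *m W^T
                   *m (point X i - point X j)) / (2 * sigma ^+ 2)).

Definition degree (R : realType) (n d q : nat) (sigma : R)
    (X : 'M[R]_(n, d)) (W : 'M[R]_(d, q)) : 'rV[R]_n :=
  const_mx 1 *m kernel_mx sigma X W.

(* D^{-1/2} for D = diag(degree); the entries of degree are positive. *)
Definition degree_invsqrt (R : realType) (n d q : nat) (sigma : R)
    (X : 'M[R]_(n, d)) (W : 'M[R]_(d, q)) : 'M[R]_n :=
  diag_mx (map_mx (fun t : R => (Num.sqrt t)^-1) (degree sigma X W)).

Definition centering_mx (R : realType) (n : nat) : 'M[R]_n :=
  1%:M - n%:R^-1 *: (const_mx 1 *m (const_mx 1 : 'cV[R]_n)^T).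

Definition gamma_mx (R : realType) (n d q k : nat) (sigma lambda : R)
    (X : 'M[R]_(n, d)) (W' : 'M[R]_(d, q)) (U Y : 'M[R]_(n, k)) : 'M[R]_n :=
  degree_invsqrt sigma X W' *m centering_mx R n
    *m (U *m U^T - lambda *: (Y *m Y^T))
    *m centering_mx R n *m degree_invsqrt sigma X W'.

Definition Phi (R : realType) (n d q : nat) (sigma : R) (X : 'M[R]_(n, d))
    (gamma : 'M[R]_n) (W : 'M[R]_(d, q)) : 'M[R]_d :=
  \sum_(i < n) \sum_(j < n)
    (gamma i j / sigma ^+ 2 * gauss_weight sigma X W i j) *: diff_outer X i j.

(* l lists the q smallest eigenvalues of M and lbar the d - q others, with
   multiplicity as roots of the characteristic polynomial; neither list needs
   to be sorted. *)
Definition smallest_eigenvalues (R : realType) (d q : nat) (M : 'M[R]_d)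
    (l : q.-tuple R) (lbar : (d - q).-tuple R) : Prop :=
  char_poly M = \prod_(x <- l ++ lbar) ('X - x%:P)
  /\ {in l & lbar, forall x y : R, x <= y}.

(* "W = eig_min(M)" is a relation: eigenvectors are not unique. *)
Definition is_eig_min (R : realType) (d q : nat) (M : 'M[R]_d)
    (W : 'M[R]_(d, q)) : Prop :=
  exists (l : q.-tuple R) (lbar : (d - q).-tuple R),
    [/\ smallest_eigenvalues M l lbar,
        W^T *m W = 1%:M
      & forall j : 'I_q, M *m col j W = tnth l j *: col j W].

Definition ISM_fixed_point (R : realType) (n d q : nat) (sigma : R)
    (X : 'M[R]_(n, d)) (gamma : 'M[R]_n) (W : 'M[R]_(d, q)) : Prop :=
  is_eig_min (Phi sigma X gamma W) W.

(* Genuine minimum and maximum on nonempty sequences, 0 on [::]. *)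
Definition seq_min (R : realType) (s : seq R) : R :=
  \big[Num.min/head 0 s]_(x <- s) x.

Definition seq_max (R : realType) (s : seq R) : R :=
  \big[Num.max/head 0 s]_(x <- s) x.

Definition objective (R : realType) (n d q : nat) (sigma : R)
    (X : 'M[R]_(n, d)) (gamma : 'M[R]_n) (W : 'M[R]_(d, q)) : R :=
  - \sum_(i < n) \sum_(j < n) gamma i j * gauss_weight sigma X W i j.

Definition lagrangian (R : realType) (n d q : nat) (sigma : R)
    (X : 'M[R]_(n, d)) (gamma : 'M[R]_n) (W : 'M[R]_(d, q))
    (Lambda : 'M[R]_q) : R :=
  objective sigma X gamma W - 2^-1 * \tr (Lambda *m (W^T *m W - 1%:M)).

(* Matrix of partial derivatives, i.e. the gradient for the inner product
   tr (A^T B); ['D] is a junk value where F is not derivable, which does not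
   happen for the smooth functions considered here. *)
Definition gradient (R : realType) (m p : nat) (F : 'M[R]_(m, p) -> R)
    (W : 'M[R]_(m, p)) : 'M[R]_(m, p) :=
  \matrix_(i, j) 'D_(delta_mx i j) F W.

(* Main.v *)
(** The multiplier is the diagonal matrix D of the eigenvalues attached to the
    columns of W. A tangent vector splits as Z = W S + E with S skew-symmetric
    and W^T E = 0. The Hessian form at Z is
    [tr (Z^T Phi Z) - tr (Z^T Z D)] minus a weighted sum of the squares
    [tr (Z^T A_ij W)^2]. In the first part the contribution of S cancels because
    S is skew, and what remains is at least the eigengap times [tr (E^T E)],
    since Phi is bounded below by its next eigenvalue on the orthogonal
    complement of W. In the second part S disappears because W^T A_ij W is
    symmetric, and Cauchy-Schwarz gives
    [tr (Z^T A_ij W)^2 <= tr (E^T E) * tr (A_ij^T A_ij)]; the lower bound on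
    sigma compares the two. *)
Require Import Defs.
From HB Require Import structures.
From mathcomp Require Import all_boot all_order all_algebra.
From mathcomp Require Import all_classical all_reals all_analysis.
From mathcomp Require Import complex ring lra.
Import Order.TTheory GRing.Theory Num.Theory.
Import numFieldNormedType.Exports.
Local Open Scope ring_scope.

Set Implicit Arguments.
Unset Strict Implicit.
Unset Printing Implicit Defensive.

(** * Spectral theorem for real symmetric matrices, through the complex extension *)

Lemma char_poly_conj (F : fieldType) n (P D : 'M[F]_n) : P \in unitmx ->
  char_poly (invmx P *m D *m P) = char_poly D.
Proof.
move=> Pu; set f := @polyC F.
have PVP : map_mx f (invmx P) *m map_mx f P = 1%:M.
  by rewrite -map_mxM mulVmx // map_mx1.
have -> : char_poly (invmx P *m D *m P) =
    \det (map_mx f (invmx P) *m char_poly_mx D *m map_mx f P).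
  rewrite /char_poly /char_poly_mx mulmxBr mulmxBl !map_mxM.
  by rewrite scalar_mxC -!mulmxA PVP mulmx1.
by rewrite !det_mulmx mulrAC -det_mulmx PVP det1 mul1r.
Qed.

Lemma char_poly_diag (F : comNzRingType) n (s : 'rV[F]_n) :
  char_poly (diag_mx s) = \prod_i ('X - (s 0 i)%:P).
Proof.
rewrite char_poly_trig ?diag_mx_is_trig //.
by apply: eq_bigr => i _; rewrite mxE eqxx.
Qed.

(* [A] and [B] are the real and imaginary parts of a complex unitary matrix
   diagonalizing [M]. *)
Lemma sym_spectral (R : rcfType) n (M : 'M[R]_n) : M^T = M ->
  exists (A B : 'M[R]_n) (s : 'rV[R]_n),
    [/\ M = A^T *m diag_mx s *m A + B^T *m diag_mx s *m B,
        A^T *m A + B^T *m B = 1%:M,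
        A *m A^T + B *m B^T = 1%:M
      & char_poly M = \prod_i ('X - (s 0 i)%:P)].
Proof.
move=> Msym; pose MC := map_mx (real_complex R) M.
have MCreal : MC \is a realmx.
  by apply/mxOverP => i j; rewrite mxE complex_real.
have MCsym : MC \is symmetricmx.
  apply/is_hermitianmxP; rewrite expr0 scale1r; apply/matrixP => i j.
  by move/matrixP: Msym => /(_ i j); rewrite !mxE => ->.
have MCherm := realsym_hermsym MCsym MCreal.
have /orthomx_spectralP := hermitian_normalmx MCherm.
have spreal := hermitian_spectral_diag_real MCherm.
have := spectral_unitarymx MC.
move: (spectralmx MC) (spectral_diag MC) spreal => P sp spreal Pun MCE.
have PuV := invmx_unitary Pun.
have Pu := unitarymx_unit Pun.
pose Re_ := @complex.Re R.
pose s := map_mx Re_ sp.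
have spE k : sp 0 k = (s 0 k)%:C%C.
  have /mxOverP/(_ 0 k) := spreal; rewrite /s mxE.
  by move=> /complex_realP[x ->].
exists (map_mx Re_ P), (map_mx (@complex.Im R) P), s; split.
(* Real parts are taken entrywise in the unitary diagonalization: for real [s], the real part of
   [conj a * s * b] is [s * (Re a * Re b + Im a * Im b)]. The next two bullets treat the two
   unitarity equations alike. *)
- apply/matrixP => i j; have /matrixP/(_ i j) := MCE.
  rewrite PuV !mxE => /(congr1 Re_); rewrite /Re_ raddf_sum /= => ->.
  rewrite -big_split; apply: eq_bigr => k _.
  rewrite !mul_mx_diag !mxE spE.
  by case: (P k i) (P k j) => [a b] [a' b'] /=; ring.
- apply/matrixP => i j; have /matrixP/(_ i j) := mulVmx Pu.
  rewrite PuV !mxE => /(congr1 Re_); rewrite /Re_ raddf_sum raddfMn /= => <-.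
  rewrite -big_split; apply: eq_bigr => k _; rewrite !mxE.
  by case: (P k i) (P k j) => [a b] [a' b'] /=; ring.
- apply/matrixP => i j; have /matrixP/(_ i j) := mulmxV Pu.
  rewrite PuV !mxE => /(congr1 Re_); rewrite /Re_ raddf_sum raddfMn /= => <-.
  rewrite -big_split; apply: eq_bigr => k _; rewrite !mxE.
  by case: (P i k) (P j k) => [a b] [a' b'] /=; ring.
(* Similarity to a diagonal matrix is known over the complex extension, so the polynomials are
   compared there and the embedding is injective. *)
- apply: (@map_poly_inj _ _ (real_complex R)).
  rewrite map_char_poly -/MC MCE char_poly_conj // char_poly_diag.
  rewrite rmorph_prod; apply: eq_bigr => i _.
  by rewrite spE rmorphB /= map_polyX map_polyC.
Qed.

(** * Trace inner product: Cauchy-Schwarz, submultiplicativity, Bessel, Rayleigh bound *)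

Lemma mxtraceB (R : pzRingType) n (A B : 'M[R]_n) : \tr (A - B) = \tr A - \tr B.
Proof. exact: raddfB. Qed.

Lemma tr_gramE (R : pzRingType) m n (A : 'M[R]_(m, n)) :
  \tr (A^T *m A) = \sum_j \sum_i A i j ^+ 2.
Proof.
rewrite /mxtrace; apply: eq_bigr => j _; rewrite mxE.
by apply: eq_bigr => i _; rewrite mxE expr2.
Qed.

Lemma tr_gram_ge0 (R : realDomainType) m n (A : 'M[R]_(m, n)) :
  0 <= \tr (A^T *m A).
Proof.
by rewrite tr_gramE; apply: sumr_ge0 => j _; apply: sumr_ge0 => i _; rewrite sqr_ge0.
Qed.

Lemma tr_gram_eq0 (R : realDomainType) m n (A : 'M[R]_(m, n)) :
  \tr (A^T *m A) = 0 -> A = 0.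
Proof.
rewrite tr_gramE => /eqP; rewrite psumr_eq0 => [/allP A0|j _]; last first.
  by apply: sumr_ge0 => i _; rewrite sqr_ge0.
apply/matrixP => i j; rewrite mxE; apply/eqP; rewrite -sqrf_eq0.
have /implyP/(_ isT) := A0 j (mem_index_enum j).
rewrite psumr_eq0 => [/allP/(_ i (mem_index_enum i)) //|k _].
by rewrite sqr_ge0.
Qed.

Lemma tr_mulmx_trC (R : comNzRingType) m n (A B : 'M[R]_(m, n)) :
  \tr (A^T *m B) = \tr (B^T *m A).
Proof. by rewrite -mxtrace_tr trmx_mul trmxK. Qed.

(** With [a], [b], [c] the traces of [A^T A], [A^T B], [B^T B], the squared norm of [c A - b B] is
    [c (a c - b^2)]. Cancelling [c > 0] needs no division, and [c = 0] forces [B = 0]. *)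
Lemma tr_CauchySchwarz (R : realDomainType) m n (A B : 'M[R]_(m, n)) :
  \tr (A^T *m B) ^+ 2 <= \tr (A^T *m A) * \tr (B^T *m B).
Proof.
have [B0|c_neq0] := eqVneq (\tr (B^T *m B)) 0.
  by rewrite (tr_gram_eq0 B0) mulmx0 mxtrace0 mulmx0 mxtrace0 mulr0 expr0n.
have c_gt0 : 0 < \tr (B^T *m B) by rewrite lt_neqAle eq_sym c_neq0 tr_gram_ge0.
have := tr_gram_ge0 (\tr (B^T *m B) *: A - \tr (A^T *m B) *: B).
rewrite mulmxBr [(_ - _)^T]linearB /= ![(_ *: _)^T]linearZ /= !mulmxBl.
rewrite -!scalemxAr -!scalemxAl !(mxtraceB, mxtraceZ) (tr_mulmx_trC B A).
set a := \tr (A^T *m A); set b := \tr (A^T *m B); set c := \tr (B^T *m B).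
move=> h; rewrite -subr_ge0 -(pmulr_rge0 _ c_gt0) -/c.
by apply: le_trans h _; rewrite le_eqVlt; apply/orP; left; apply/eqP; ring.
Qed.

(** Each entry of [A B] pairs a row of [A] with a column of [B]; Cauchy-Schwarz bounds its square,
    and the double sum of the bounds factors. *)
Lemma tr_gram_mul_le (R : realDomainType) m n p (A : 'M[R]_(m, n))
    (B : 'M[R]_(n, p)) :
  \tr ((A *m B)^T *m (A *m B)) <= \tr (A^T *m A) * \tr (B^T *m B).
Proof.
have -> : \tr (A^T *m A) = \sum_i \tr ((row i A)^T *m row i A).
  rewrite tr_gramE exchange_big; apply: eq_bigr => i _; rewrite tr_gramE.
  by apply: eq_bigr => j _; rewrite big_ord1 mxE.
have -> : \tr (B^T *m B) = \sum_j \tr ((col j B)^T *m col j B).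
  rewrite tr_gramE; apply: eq_bigr => j _; rewrite tr_gramE big_ord1.
  by apply: eq_bigr => i _; rewrite mxE.
rewrite big_distrlr /= tr_gramE exchange_big.
apply: ler_sum => i _; apply: ler_sum => j _.
have := tr_CauchySchwarz (row i A)^T (col j B).
rewrite trmxK [\tr (row i A *m (row i A)^T)]mxtrace_mulC.
suff -> : (A *m B) i j = \tr (row i A *m col j B) by [].
by rewrite trace_mx11 !mxE; apply: eq_bigr => k _; rewrite !mxE.
Qed.

(* Bessel's inequality for the columns of [W], with its defect made explicit. *)
Lemma tr_gram_proj (R : realDomainType) m n q (A : 'M[R]_(m, n))
    (W : 'M[R]_(n, q)) : W^T *m W = 1%:M ->
  \tr ((A - A *m W *m W^T)^T *m (A - A *m W *m W^T)) =
  \tr (A^T *m A) - \tr ((A *m W)^T *m (A *m W)).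
Proof.
move=> WW; rewrite mxtrace_mulC [in RHS]mxtrace_mulC.
rewrite [\tr ((A *m W)^T *m _)]mxtrace_mulC -linearB; congr (\tr _).
rewrite [(_ - _)^T]linearB /= !trmx_mul trmxK mulmxBl !mulmxBr !mulmxA.
by rewrite -(mulmxA (A *m W) W^T W) WW mulmx1 subrr subr0.
Qed.

Lemma tr_gram_mul_orthonormal_le (R : realDomainType) m n q (A : 'M[R]_(m, n))
    (W : 'M[R]_(n, q)) : W^T *m W = 1%:M ->
  \tr ((A *m W)^T *m (A *m W)) <= \tr (A^T *m A).
Proof. by move=> WW; rewrite -subr_ge0 -tr_gram_proj // tr_gram_ge0. Qed.

(* The argument is that of Ky Fan's trace inequality, applied to [W] extended by
   [E]. With spectral weights [c i] of [W] and [e i] of [E], where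
   [e i <= t * (1 - c i)] by Bessel, the bound
   [(s i - m) * e i >= t * (min (s i - m) 0 - (s i - m) * c i)]
   holds term by term, and its right-hand side sums to zero. *)
Lemma rayleigh_orthogonal_ge (R : rcfType) n q p r (M : 'M[R]_n)
    (W : 'M[R]_(n, q)) (E : 'M[R]_(n, p)) (l : q.-tuple R) (lbar : r.-tuple R)
    (m : R) :
  M^T = M -> char_poly M = \prod_(x <- l ++ lbar) ('X - x%:P) ->
  W^T *m W = 1%:M -> M *m W = W *m diag_mx (\row_j tnth l j) ->
  {in l, forall x, x <= m} -> {in lbar, forall x, m <= x} ->
  W^T *m E = 0 ->
  m * \tr (E^T *m E) <= \tr (E^T *m M *m E).
Proof.
move=> Msym; have [A [B [s [ME AB1 AB2 ->]]]] := sym_spectral Msym.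
move=> chiE WW MW l_le lbar_ge WE.
(* Unique factorization of the characteristic polynomial identifies the spectral values with the
   listed eigenvalues, up to order. *)
have perm_s : perm_eq [seq s 0 i | i <- enum 'I_n] (l ++ lbar).
  by apply: prod_XsubC_eq; rewrite -chiE big_map big_enum.
(* [wt V i] is the squared norm of the coordinates of the columns of [V] along the i-th complex
   eigenvector; rows [i] of [A] and [B] account for its real and imaginary parts. *)
pose w k (a : 'rV[R]_n) (V : 'M[R]_(n, k)) := \tr ((a *m V)^T *m (a *m V)).
pose wt k (V : 'M[R]_(n, k)) i := w k (row i A) V + w k (row i B) V.
have w_ge0 k a V : 0 <= w k a V by exact: tr_gram_ge0.
have wtE k (V : 'M[R]_(n, k)) i :
    wt k V i = (A *m V *m V^T *m A^T + B *m V *m V^T *m B^T) i i.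
  rewrite -!(mulmxA (_ *m V)) -!trmx_mul /wt /w -!row_mul !(mxtrace_mulC (_ ^T)).
  rewrite !trace_mx11 !mxE.
  by congr (_ + _); apply: eq_bigr => j _; rewrite !mxE.
have trE k (V : 'M[R]_(n, k)) (D Q : 'M[R]_n) :
    \tr (D *m (Q *m V *m V^T *m Q^T)) = \tr (V^T *m (Q^T *m D *m Q) *m V).
  by rewrite -(mulmxA (Q *m V)) mulmxA mxtrace_mulC !mulmxA.
have sum_wt k (V : 'M[R]_(n, k)) : \sum_i wt k V i = \tr (V^T *m V).
  under eq_bigr do rewrite wtE.
  rewrite -/(mxtrace _) -[X in \tr X]mul1mx mulmxDr mxtraceD !trE.
  by rewrite -mxtraceD -mulmxDl -mulmxDr !mulmx1 AB1 mulmx1.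
have sum_swt k (V : 'M[R]_(n, k)) :
    \sum_i s 0 i * wt k V i = \tr (V^T *m M *m V).
  rewrite ME mulmxDr mulmxDl mxtraceD -!trE -mxtraceD -mulmxDr.
  by apply: eq_bigr => i _; rewrite wtE mul_diag_mx !mxE.
set t := \tr (E^T *m E).
have t_ge0 : 0 <= t by exact: tr_gram_ge0.
(* Since [W^T E = 0], [a] may be replaced by its component orthogonal to the columns of [W], whose
   squared norm is the Bessel defect. *)
have besselr (a : 'rV[R]_n) : w p a E <= t * (\tr (a^T *m a) - w q a W).
  have -> : w p a E = w p (a - a *m W *m W^T) E.
    by rewrite /w mulmxBl -!mulmxA WE !mulmx0 subr0.
  by rewrite mulrC -tr_gram_proj // tr_gram_mul_le.
have bessel i : wt p E i <= t * (1 - wt q W i).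
  suff <- : \tr ((row i A)^T *m row i A) + \tr ((row i B)^T *m row i B) = 1.
    by rewrite opprD addrACA mulrDr lerD ?besselr.
  have /matrixP/(_ i i) := AB2; rewrite !mxE eqxx mulr1n => <-.
  rewrite !(mxtrace_mulC (_ ^T)) !trace_mx11 !mxE.
  by congr (_ + _); apply: eq_bigr => j _; rewrite !mxE.
have termwise i : t * (Num.min (s 0 i - m) 0 - (s 0 i - m) * wt q W i)
    <= (s 0 i - m) * wt p E i.
  have c_ge0 : 0 <= wt q W i by rewrite addr_ge0.
  have e_ge0 : 0 <= wt p E i by rewrite addr_ge0.
  have := bessel i; case: (lerP (s 0 i - m) 0) => [x_le0 le_e | x_gt0 _].
    by rewrite -{1}[s 0 i - m]mulr1 -mulrBr mulrCA ler_wnM2l.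
  apply: (@le_trans _ _ 0); last by rewrite mulr_ge0 // ltW.
  by rewrite mulr_ge0_le0 // sub0r oppr_le0 mulr_ge0 // ltW.
(* Capping at 0 leaves the terms from [l] unchanged and sends those from [lbar] to 0. *)
have sum_min : \sum_i Num.min (s 0 i - m) 0 = \sum_j (tnth l j - m).
  have -> : \sum_i Num.min (s 0 i - m) 0 =
      \sum_(x <- [seq s 0 i | i <- enum 'I_n]) Num.min (x - m) 0.
    by rewrite big_map big_enum.
  rewrite (perm_big _ perm_s) big_cat /= [X in _ + X]big1_seq => [|x /= x_lbar].
    rewrite addr0 -(big_tuple _ _ l xpredT (fun x => x - m)); apply: eq_big_seq => x x_l.
    by apply/min_idPl; rewrite subr_le0 l_le.
  by apply/min_idPr; rewrite subr_ge0 lbar_ge.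
rewrite -subr_ge0 /t -sum_swt -sum_wt mulr_sumr -sumrB.
under eq_bigr do rewrite -mulrBl.
apply: le_trans (ler_sum _ (fun i _ => termwise i)).
rewrite -mulr_sumr sumrB sum_min.
(* Both sides are the trace of [W^T (M - m) W], computed from the spectral weights on the left and
   from [M W = W diag(l)] on the right. *)
suff -> : \sum_i (s 0 i - m) * wt q W i = \sum_j (tnth l j - m).
  by rewrite subrr mulr0.
under eq_bigr do rewrite mulrBl.
rewrite !sumrB -mulr_sumr sum_wt sum_swt -mulmxA MW mulmxA WW mul1mx.
rewrite mxtrace_diag mxtrace1 sumr_const card_ord mulr_natr.
by congr (_ - _); apply: eq_bigr => j _; rewrite mxE.
Qed.

(** * Tangent vectors to the orthonormality constraint *)

Lemma tr_skew_sym (R : realDomainType) n (S B : 'M[R]_n) :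
  S^T = - S -> B^T = B -> \tr (S^T *m B) = 0.
Proof.
move=> Sskew Bsym; have : \tr (S^T *m B) = - \tr (S^T *m B).
  by rewrite {1}tr_mulmx_trC Bsym mxtrace_mulC Sskew mulNmx raddfN opprK.
by lra.
Qed.

Section TangentVectors.
Variables (R : realFieldType) (d q : nat) (W Z : 'M[R]_(d, q)).
Hypothesis WW : W^T *m W = 1%:M.
Hypothesis ZW : Z^T *m W + W^T *m Z = 0.

Let S := W^T *m Z.
Let E := Z - W *m S.

Let ZE : Z = W *m S + E. Proof. by rewrite addrC subrK. Qed.

Let S_skew : S^T = - S.
Proof. by apply/eqP; rewrite -addr_eq0 trmx_mul trmxK ZW. Qed.

Lemma tangent_normal : W^T *m E = 0.
Proof. by rewrite mulmxBr mulmxA WW mul1mx subrr. Qed.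

Let EW : E^T *m W = 0.
Proof. by apply: trmx_inj; rewrite trmx_mul trmxK tangent_normal trmx0. Qed.

(** Cross terms vanish because [W^T E = 0] and [M] preserves the span of [W]. Skewness turns both
    [tr (S^T D S)] and [tr (S^T S D)] into [- tr (S S D)], so they cancel. *)
Lemma tangent_quadratic (M D : 'M[R]__) : M^T = M -> D^T = D -> M *m W = W *m D ->
  \tr (Z^T *m M *m Z) - \tr (Z^T *m Z *m D) =
  \tr (E^T *m M *m E) - \tr (E^T *m E *m D).
Proof.
move=> Msym Dsym MW; have WM : W^T *m M = D *m W^T.
  by rewrite -Msym -trmx_mul MW trmx_mul Dsym.
have -> : Z^T *m M *m Z = S^T *m D *m S + E^T *m M *m E.
  have MZ : M *m Z = W *m D *m S + M *m E by rewrite {1}ZE mulmxDr mulmxA MW.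
  rewrite {1}ZE [(_ + _)^T]linearD /= trmx_mul -mulmxA mulmxDl {2}MZ mulmxDr.
  by rewrite -(mulmxA S^T) (mulmxA W^T) WM !mulmxA EW !mul0mx add0r -(mulmxA _ W^T).
have -> : Z^T *m Z = S^T *m S + E^T *m E.
  rewrite {1}ZE [(_ + _)^T]linearD /= trmx_mul mulmxDl -mulmxA -/S; congr (_ + _).
  by rewrite {1}ZE mulmxDr mulmxA EW mul0mx add0r.
rewrite mulmxDl !mxtraceD; have -> : \tr (S^T *m D *m S) = \tr (S^T *m S *m D).
  by rewrite S_skew !mulNmx !raddfN /= mxtrace_mulC mulmxA.
by rewrite opprD addrACA subrr add0r.
Qed.

Lemma tangent_cross_le (A : 'M[R]_d) : A^T = A ->
  \tr (Z^T *m A *m W) ^+ 2 <= \tr (E^T *m E) * \tr (A^T *m A).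
Proof.
move=> Asym; have -> : \tr (Z^T *m A *m W) = \tr (E^T *m (A *m W)).
  rewrite {1}ZE [(_ + _)^T]linearD /= trmx_mul !mulmxDl mxtraceD -!mulmxA tr_skew_sym ?add0r //.
  by rewrite !trmx_mul trmxK Asym mulmxA.
apply: le_trans (tr_CauchySchwarz _ _) _.
(* Multiplying [A] by the orthonormal columns of [W] does not increase its Frobenius norm. *)
by rewrite ler_wpM2l ?tr_gram_ge0 ?tr_gram_mul_orthonormal_le.
Qed.

End TangentVectors.

(** * Eigenvalue lists up to order, and their extreme values *)

Lemma smallest_eigenvalues_perm (R : realType) (d q : nat) (M : 'M[R]_d)
    (l l' : q.-tuple R) (lbar lbar' : (d - q).-tuple R) :
  smallest_eigenvalues M l lbar -> smallest_eigenvalues M l' lbar' ->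
  perm_eq l l' /\ perm_eq lbar lbar'.
Proof.
move=> [chiE le_l] [chiE' le_l'].
(* Sorting the two lists separately already sorts their concatenation. Two sorted rearrangements of
   the same spectrum coincide, and cutting both after [q] entries separates the lists. *)
have sorted_cat (s t : seq R) : {in s & t, forall x y, x <= y} ->
    sorted <=%O (sort <=%O s ++ sort <=%O t).
  move=> le_st; rewrite sorted_pairwise ?pairwise_cat; last exact: le_trans.
  rewrite -!sorted_pairwise ?sort_le_sorted ?andbT; [|exact: le_trans..].
  by apply/allrelP => x y; rewrite !mem_sort; apply: le_st.
have : perm_eq (sort <=%O l ++ sort <=%O lbar) (sort <=%O l' ++ sort <=%O lbar').
  have perm_ll : perm_eq (l ++ lbar) (l' ++ lbar').
    by apply: prod_XsubC_eq; rewrite -chiE -chiE'.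
  apply: perm_trans (perm_trans _ perm_ll) _.
    by apply: perm_cat; rewrite perm_sort.
  by rewrite perm_sym; apply: perm_cat; rewrite perm_sort.
move=> /(sorted_eq le_trans le_anti (sorted_cat _ _ le_l) (sorted_cat _ _ le_l')).
move=> /eqP; rewrite eqseq_cat ?size_sort ?size_tuple // => /andP[/eqP ll /eqP bb].
by split; apply/(perm_sort_leP _ _) => //; rewrite ?ll ?bb.
Qed.

Lemma seq_min_le (R : realType) (s : seq R) (x : R) : x \in s -> seq_min s <= x.
Proof.
(* The starting value is generalized because [head 0 s] would change with the tail in the
   induction. *)
rewrite /seq_min; move: (head 0 s) => y; elim: s => // z s IHs.
by rewrite inE big_cons ge_min => /predU1P[->|/IHs ->]; rewrite ?lexx ?orbT.
Qed.

Lemma seq_min_in (R : realType) (s : seq R) : s != [::] -> seq_min s \in s.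
Proof.
case: s => // y s _; rewrite /seq_min big_cons /=.
suff : \big[Num.min/y]_(x <- s) x \in y :: s.
  by rewrite minEle; case: ifP => // _; rewrite mem_head.
elim: s => [|z s]; first by rewrite big_nil mem_head.
rewrite big_cons minEle; case: ifP => _; rewrite !inE ?eqxx ?orbT //.
by case/orP=> ->; rewrite ?orbT.
Qed.

Lemma seq_max_ge (R : realType) (s : seq R) (x : R) : x \in s -> x <= seq_max s.
Proof.
rewrite /seq_max; move: (head 0 s) => y; elim: s => // z s IHs.
by rewrite inE big_cons le_max => /predU1P[->|/IHs ->]; rewrite ?lexx ?orbT.
Qed.

(** * Derivatives of the kernel weights, the Lagrangian and its gradient *)

Section Derivatives.
Variables (R : realType).

(** Reduces a directional derivative on a matrix space to a derivative in one real variable, where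
    the chain rule for [expR] applies. *)
Lemma is_derive_along (V : normedModType R) (f : V -> R) (a v : V) (df : R) :
  is_derive (0 : R) 1 (fun h : R => f (h *: v + a)) df -> is_derive a v f df.
Proof.
case=> [fder <-]; split; first exact/derivable1P.
rewrite /derive; set g1 := fun h => h^-1 *: _; set g2 := fun h => h^-1 *: _.
suff -> : g1 = g2 by [].
by rewrite funeqE /g1 /g2 => h /=; rewrite addr0 scale0r add0r [_%:A]mulr1.
Qed.

(** Serves for the linear and quadratic matrix expressions below, whose restrictions to lines are
    polynomials of degree at most 2. *)
Lemma is_derive_along_poly (V : normedModType R) (f : V -> R) (a v : V)
    (c0 c1 c2 : R) :
  (forall h, f (h *: v + a) = c0 + c1 * h + c2 * h ^+ 2) -> is_derive a v f c1.
Proof.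
move=> fE; apply: is_derive_along; pose p := c0%:P + c1 *: 'X + c2 *: 'X^2.
rewrite (_ : (fun h => _) = horner p); last first.
  by apply/funext => h; rewrite fE !hornerE.
apply: is_derive_eq; rewrite !poly.derivE !hornerE /=.
by rewrite mulr0 mul0r addr0.
Qed.

Lemma is_derive_sumf (V : normedModType R) n (h : 'I_n -> V -> R) (x v : V)
    (dh : 'I_n -> R) : (forall i, is_derive x v (h i) (dh i)) ->
  is_derive x v (fun y => \sum_(i < n) h i y) (\sum_(i < n) dh i).
Proof.
move=> hder; rewrite (_ : (fun y => _) = \sum_(i < n) h i).
  exact: is_derive_sum.
by apply/funext => y; rewrite fct_sumE.
Qed.

Lemma derive_mxE (V : normedModType R) m n (M : V -> 'M[R]_(m, n)) (x v : V)
    (dM : 'M[R]_(m, n)) :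
  (forall i j, is_derive x v (fun y => M y i j) (dM i j)) -> 'D_v M x = dM.
Proof.
move=> Mder; rewrite derive_mx; last by apply/derivable_mxP => i j; case: (Mder i j).
by apply/matrixP => i j; rewrite mxE; case: (Mder i j).
Qed.

Lemma gradientE m p (F : 'M[R]_(m, p) -> R) (V G : 'M[R]_(m, p)) :
  (forall Z, is_derive V Z F (\tr (Z^T *m G))) -> gradient F V = G.
Proof.
move=> Fder; apply/matrixP => i j; rewrite mxE.
case: (Fder (delta_mx i j)) => _ ->.
rewrite trmx_delta /mxtrace (bigD1 j) //= big1 ?addr0 => [|k kj]; last first.
  by rewrite mxE big1 // => l _; rewrite mxE (negPf kj) mul0r.
rewrite mxE (bigD1 i) //= big1 ?addr0 => [|k ki]; first by rewrite mxE !eqxx mul1r.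
by rewrite mxE (negPf ki) andbF mul0r.
Qed.

Lemma is_derive_mulmx m p r c (A : 'M[R]_(m, p)) (B : 'M[R]_(r, c))
    (V Z : 'M[R]_(p, r)) i j :
  is_derive V Z (fun V => (A *m V *m B) i j) ((A *m Z *m B) i j).
Proof.
apply: (@is_derive_along_poly _ _ _ _ ((A *m V *m B) i j) _ 0) => h.
rewrite mulmxDr mulmxDl -scalemxAr -scalemxAl !mxE mul0r addr0 addrC.
by congr (_ + _); rewrite mulrC.
Qed.

Lemma diff_outer_sym n d (X : 'M[R]_(n, d)) i j :
  (diff_outer X i j)^T = diff_outer X i j.
Proof. by rewrite /diff_outer trmx_mul trmxK. Qed.

Lemma tr_quadratic_line d q (A : 'M[R]_d) (V Z : 'M[R]_(d, q)) (h : R) :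
  A^T = A ->
  \tr ((h *: Z + V)^T *m A *m (h *: Z + V)) =
  \tr (V^T *m A *m V) + 2 * \tr (Z^T *m A *m V) * h
    + \tr (Z^T *m A *m Z) * h ^+ 2.
Proof.
move=> Asym; rewrite [(_ + _)^T]linearD /= [(_ *: _)^T]linearZ /=.
rewrite !mulmxDl !mulmxDr -!scalemxAl -!scalemxAr !(mxtraceD, mxtraceZ).
have -> : \tr (V^T *m A *m Z) = \tr (Z^T *m A *m V).
  by rewrite -mxtrace_tr !trmx_mul trmxK Asym mulmxA.
by ring.
Qed.

Variables (n d q : nat) (sigma : R) (X : 'M[R]_(n, d)) (gamma : 'M[R]_n).
Hypothesis sigma_neq0 : sigma != 0.
Implicit Types V Z : 'M[R]_(d, q).

Lemma is_derive_gauss_weight V Z i j :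
  is_derive V Z (fun V => gauss_weight sigma X V i j)
    (- (gauss_weight sigma X V i j
          * \tr (Z^T *m diff_outer X i j *m V) / sigma ^+ 2)).
Proof.
apply: is_derive_along; set A := diff_outer X i j.
pose p h : R := - \tr ((h *: Z + V)^T *m A *m (h *: Z + V)) / (2 * sigma ^+ 2).
(* The two equal cross terms of the quadratic form cancel the 2 in [2 * sigma ^+ 2]. *)
have pder : is_derive (0 : R) 1 p (- \tr (Z^T *m A *m V) / sigma ^+ 2).
  apply: (@is_derive_along_poly _ _ _ _ (- \tr (V^T *m A *m V) / (2 * sigma ^+ 2))
    _ (- \tr (Z^T *m A *m Z) / (2 * sigma ^+ 2))) => h.
  rewrite /p [h *: 1]mulr1 addr0 tr_quadratic_line ?diff_outer_sym //.
  by field.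
have := is_derive1_comp (is_derive_expR _) pder.
rewrite /p scale0r add0r => /is_derive_eq; apply.
by rewrite /gauss_weight -/A; field.
Qed.

(** The minus sign of the objective cancels that of the weight's derivative, producing [Phi].
    Symmetry of [L] makes the two cross terms of the constraint equal, which absorbs the factor
    1/2. *)
Lemma is_derive_lagrangian (L : 'M[R]_q) V Z : L^T = L ->
  is_derive V Z (fun V => lagrangian sigma X gamma V L)
    (\tr (Z^T *m (Phi sigma X gamma V *m V - V *m L))).
Proof.
move=> Lsym; pose g V i j := gauss_weight sigma X V i j.
have objder : is_derive V Z (objective sigma X gamma)
    (- \sum_(i < n) \sum_(j < n) gamma i j *
        - (g V i j * \tr (Z^T *m diff_outer X i j *m V) / sigma ^+ 2)).
  apply: is_deriveN; apply: is_derive_sumf => i; apply: is_derive_sumf => j.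
  exact: is_deriveZ (is_derive_gauss_weight V Z i j).
have conder : is_derive V Z (fun V => 2^-1 * \tr (L *m (V^T *m V - 1%:M)))
    (\tr (Z^T *m (V *m L))).
  apply: (@is_derive_along_poly _ _ _ _ (2^-1 * \tr (L *m (V^T *m V - 1%:M))) _
    (2^-1 * \tr (L *m (Z^T *m Z)))) => h.
  rewrite [(_ + _)^T]linearD /= [(_ *: _)^T]linearZ /=.
  rewrite !mulmxBr !mulmxDl !mulmxDr -!scalemxAl -!scalemxAr.
  rewrite !(mxtraceB, mxtraceD, mxtraceZ).
  have -> : \tr (L *m (V^T *m Z)) = \tr (L *m (Z^T *m V)).
    by rewrite -mxtrace_tr !trmx_mul trmxK Lsym mxtrace_mulC.
  have -> : \tr (Z^T *m (V *m L)) = \tr (L *m (Z^T *m V)).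
    by rewrite mulmxA mxtrace_mulC.
  by field.
apply: is_derive_eq (is_deriveB objder conder) _.
rewrite mulmxBr mxtraceB; congr (_ - _).
rewrite /Phi mulmx_suml mulmx_sumr [\tr _]raddf_sum /= -sumrN; apply: eq_bigr => i _.
rewrite mulmx_suml mulmx_sumr [\tr _]raddf_sum /= -sumrN; apply: eq_bigr => j _.
rewrite -scalemxAl -scalemxAr /= mxtraceZ (mulmxA _ (diff_outer X i j)) /g.
by field.
Qed.

(** Product rule: the last sum comes from differentiating the weights inside [Phi], which adds a
    second factor [sigma ^- 2]. *)
Lemma derive_Phi_mul (L : 'M[R]_q) V Z :
  'D_Z (fun V => Phi sigma X gamma V *m V - V *m L) V =
  Phi sigma X gamma V *m Z - Z *m L
  - \sum_(i < n) \sum_(j < n)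
      (gamma i j / sigma ^+ 4 * gauss_weight sigma X V i j
        * \tr (Z^T *m diff_outer X i j *m V)) *: (diff_outer X i j *m V).
Proof.
have subE (M N : 'M[R]_(d, q)) k c : (M - N) k c = M k c - N k c by rewrite !mxE.
apply: derive_mxE => k c; pose g V i j := gauss_weight sigma X V i j.
(* Identity factors give every product the two-sided shape expected by [is_derive_mulmx]. *)
have -> : (fun V => (Phi sigma X gamma V *m V - V *m L) k c) =
    (fun V => \sum_(i < n) \sum_(j < n) gamma i j / sigma ^+ 2 *
      (g V i j * (diff_outer X i j *m V *m 1%:M) k c) - (1%:M *m V *m L) k c).
  apply/funext => y; rewrite mul1mx subE /Phi mulmx_suml summxE; congr (_ - _).
  apply: eq_bigr => i _; rewrite mulmx_suml summxE; apply: eq_bigr => j _.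
  by rewrite mulmx1 -scalemxAl mxE mulrA.
pose dg i j := - (g V i j * \tr (Z^T *m diff_outer X i j *m V) / sigma ^+ 2).
have der : is_derive V Z (fun V => \sum_(i < n) \sum_(j < n) gamma i j / sigma ^+ 2 *
      (g V i j * (diff_outer X i j *m V *m 1%:M) k c))
    (\sum_(i < n) \sum_(j < n) gamma i j / sigma ^+ 2 *
      (g V i j * (diff_outer X i j *m Z *m 1%:M) k c +
       (diff_outer X i j *m V *m 1%:M) k c * dg i j)).
  apply: is_derive_sumf => i; apply: is_derive_sumf => j.
  exact: is_deriveZ (is_deriveM (is_derive_gauss_weight V Z i j)
    (is_derive_mulmx _ _ V Z k c)).
apply: is_derive_eq (is_deriveB der (is_derive_mulmx 1%:M L V Z k c)) _.
rewrite mul1mx !subE addrAC; congr (_ - _).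
rewrite /Phi mulmx_suml !summxE -sumrB; apply: eq_bigr => i _.
rewrite mulmx_suml !summxE -sumrB; apply: eq_bigr => j _.
rewrite !mulmx1 -scalemxAl [in RHS]mxE [(_ *: (_ *m V)) k c]mxE /dg /g.
by field.
Qed.

End Derivatives.

(** * First- and second-order conditions at the fixed point *)

Lemma tr_gram_diag_le (R : realDomainType) m n (E : 'M[R]_(m, n)) (s : 'rV[R]_n)
    (b : R) : (forall j, s 0 j <= b) ->
  \tr (E^T *m E *m diag_mx s) <= b * \tr (E^T *m E).
Proof.
move=> s_le; rewrite mulr_sumr; apply: ler_sum => j _.
rewrite mul_mx_diag mxE mulrC ler_wpM2r // mxE sumr_ge0 // => i _.
by rewrite mxE -expr2 sqr_ge0.
Qed.

Unset Implicit Arguments.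

Theorem theorem1 (R : realType) (n d q k : nat) (sigma lambda : R)
    (X : 'M[R]_(n, d)) (W' : 'M[R]_(d, q)) (U Y : 'M[R]_(n, k))
    (C : 'I_k -> {set 'I_n}) (gamma : 'M[R]_n) (W : 'M[R]_(d, q))
    (Lam : q.-tuple R) (Lambar : (d - q).-tuple R)
    (n_gt0 : (0 < n)%N) (q_gt0 : (0 < q)%N) (q_ltd : (q < d)%N)
    (sigma_gt0 : 0 < sigma)
    (U_orthonormal : U^T *m U = 1%:M)
    (Y_indicator : forall i j, Y i j = (i \in C j)%:R)
    (gammaE : gamma = gamma_mx sigma lambda X W' U Y)
    (W_fixed : ISM_fixed_point sigma X gamma W)
    (Phi_eigenvalues : smallest_eigenvalues (Phi sigma X gamma W) Lam Lambar)
    (Phi_full_rank : \rank (Phi sigma X gamma W) = d)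
    (sigma_large :
       sigma ^+ 2 * (seq_min Lambar - seq_max Lam) >=
       \sum_(i < n) \sum_(j < n)
         `|gamma i j| / sigma ^+ 2 * gauss_weight sigma X W i j
           * \tr ((diff_outer X i j)^T *m diff_outer X i j)) :
  exists Lambda : 'M[R]_q,
    [/\ gradient (fun V : 'M[R]_(d, q) => lagrangian sigma X gamma V Lambda) W
          = 0,
        gradient (fun L : 'M[R]_q => lagrangian sigma X gamma W L) Lambda = 0
      & forall Z : 'M[R]_(d, q), Z != 0 -> Z^T *m W + W^T *m Z = 0 ->
          0 <= \tr (Z^T *m
                 'D_Z (gradient (fun V : 'M[R]_(d, q) =>
                                   lagrangian sigma X gamma V Lambda)) W)].
Proof.
set M := Phi sigma X gamma W in Phi_eigenvalues *.
case: W_fixed => l [lbar [eig_l WW Wcol]].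
have [perm_l perm_lbar] := smallest_eigenvalues_perm eig_l Phi_eigenvalues.
have s2_gt0 : 0 < sigma ^+ 2 by rewrite exprn_gt0.
have s_neq0 : sigma != 0 by rewrite gt_eqF.
(* The list [l] supplied by the fixed point follows the columns of [W]; [Lam] is only a
   rearrangement of it. *)
pose D : 'M[R]_q := diag_mx (\row_j tnth l j).
have Dsym : D^T = D by exact: tr_diag_mx.
have Msym : M^T = M.
  rewrite /M /Phi !raddf_sum; apply: eq_bigr => i _; rewrite raddf_sum.
  by apply: eq_bigr => j _; rewrite /= linearZ /= diff_outer_sym.
have MW : M *m W = W *m D.
  apply/matrixP => i j; have /matrixP/(_ i 0) := Wcol j.
  rewrite mul_mx_diag !mxE mulrC => <-.
  by apply: eq_bigr => k' _; rewrite mxE.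
exists D; split.
- rewrite (gradientE (fun Z => is_derive_lagrangian X gamma s_neq0 W Z Dsym)).
  by rewrite MW subrr.
(* At [W] the constraint holds, so the Lagrangian is constant in the multiplier. *)
- rewrite (_ : (fun L => _) = cst (objective sigma X gamma W)); last first.
    by apply/funext => L; rewrite /lagrangian WW subrr mulmx0 mxtrace0 mulr0 subr0.
  by apply/matrixP => i j; rewrite !mxE derive_cst.
move=> Z _ ZW.
have -> : gradient (fun V => lagrangian sigma X gamma V D) =
    (fun V => Phi sigma X gamma V *m V - V *m D).
  apply/funext => V.
  exact: (gradientE (fun Z => is_derive_lagrangian X gamma s_neq0 V Z Dsym)).
rewrite derive_Phi_mul // -/M.
pose E := Z - W *m (W^T *m Z); set t := \tr (E^T *m E).
have t_ge0 : 0 <= t by exact: tr_gram_ge0.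
have min_le x : x \in lbar -> seq_min Lambar <= x.
  by rewrite (perm_mem perm_lbar) => /seq_min_le.
have le_max x : x \in l -> x <= seq_max Lam.
  by rewrite (perm_mem perm_l) => /seq_max_ge.
(* As [q < d], the list is nonempty and [seq_min] is a true eigenvalue, not the default 0; hence it
   bounds [l] from above. *)
have min_lbar : seq_min Lambar \in lbar.
  rewrite (perm_mem perm_lbar) seq_min_in // -size_eq0 size_tuple subn_eq0.
  by rewrite -ltnNge.
have upper : \tr (E^T *m E *m D) <= seq_max Lam * t.
  by apply: tr_gram_diag_le => j; rewrite mxE le_max ?mem_tnth.
have lower : seq_min Lambar * t <= \tr (E^T *m M *m E).
  case: (eig_l) => chiE l_le.
  apply: (rayleigh_orthogonal_ge Msym chiE WW MW) => // [x x_l|].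
    exact: l_le.
  exact: tangent_normal.
set S := \sum_(i < n) _ in sigma_large.
have -> : \tr (Z^T *m (M *m Z - Z *m D - \sum_(i < n) \sum_(j < n)
      (gamma i j / sigma ^+ 4 * gauss_weight sigma X W i j
        * \tr (Z^T *m diff_outer X i j *m W)) *: (diff_outer X i j *m W))) =
    \tr (E^T *m M *m E) - \tr (E^T *m E *m D) - \sum_(i < n) \sum_(j < n)
      gamma i j / sigma ^+ 4 * gauss_weight sigma X W i j
        * \tr (Z^T *m diff_outer X i j *m W) ^+ 2.
  rewrite -(tangent_quadratic WW ZW Msym Dsym MW) !mulmxBr !mxtraceB !mulmxA.
  congr (_ - _); rewrite mulmx_sumr raddf_sum; apply: eq_bigr => i _ /=.
  rewrite mulmx_sumr raddf_sum; apply: eq_bigr => j _ /=.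
  by rewrite -scalemxAr mxtraceZ (mulmxA _ (diff_outer X i j)) expr2 mulrA.
have cross : \sum_(i < n) \sum_(j < n) gamma i j / sigma ^+ 4 *
    gauss_weight sigma X W i j * \tr (Z^T *m diff_outer X i j *m W) ^+ 2
    <= (seq_min Lambar - seq_max Lam) * t.
  (* The cross terms carry [sigma ^- 4] while [S] carries [sigma ^- 2], so [sigma_large] is used
     divided by [sigma ^+ 2]. *)
  apply: (@le_trans _ _ (S / sigma ^+ 2 * t)); last first.
    by rewrite ler_wpM2r // ler_pdivrMr // mulrC.
  rewrite /S !mulr_suml; apply: ler_sum => i _; rewrite !mulr_suml.
  apply: ler_sum => j _.
  have := tangent_cross_le WW ZW (diff_outer_sym X i j); rewrite -/E -/t => le_cross.
  set g := gauss_weight _ _ _ _ _; have g_ge0 : 0 <= g by exact: expR_ge0.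
  have -> : `|gamma i j| / sigma ^+ 2 * g *
      \tr ((diff_outer X i j)^T *m diff_outer X i j) / sigma ^+ 2 * t =
      `|gamma i j| / sigma ^+ 4 * g *
      (t * \tr ((diff_outer X i j)^T *m diff_outer X i j)) by field.
  have div_ge0 : 0 <= (sigma ^+ 4)^-1 by rewrite invr_ge0 exprn_ge0 // ltW.
  (* The sign of [gamma i j] is unknown, so it is replaced by its absolute value before the
     Cauchy-Schwarz bound is applied. *)
  apply: (@le_trans _ _ (`|gamma i j| / sigma ^+ 4 * g *
      \tr (Z^T *m diff_outer X i j *m W) ^+ 2)).
    by rewrite ler_wpM2r ?sqr_ge0 // ler_wpM2r // ler_wpM2r // ler_norm.
  by rewrite ler_wpM2l // !mulr_ge0.
rewrite mulrBl in cross.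
by lra.
Qed.
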